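(* Let $M$ be an $F$-manifold of dimension $n$ with product $\circ$ given by the $(1,2)$-tensor field $c$, endowed with a torsionless (not necessarily flat) connection $\nabla$ satisfying $(\nabla_Xc)(Y,Z)=(\nabla_Yc)(X,Z)$ for all vector fields $X,Y,Z$. If $X$ and $Y$ are two vector fields satisfying $$(\nabla_Z X)\circ W=(\nabla_W X)\circ Z,\qquad (\nabla_Z Y)\circ W=(\nabla_W Y)\circ Z$$ for all pairs $(Z,W)$ of vector fields, then the associated flows $$u^i_t=c^i_{jk}X^k u^j_x\qquad\text{and}\qquad u^i_\tau=c^i_{jk}Y^k u^j_x\qquad (i=1,\dots,n)$$ commute.
   Context: Sum over repeated indices is understood; $(u^1,\dots,u^n)$ are local coordinates on $M$. An $F$-manifold is a smooth manifold endowed with a commutative associative product on vector fields $(X\circ Y)^i=c^i_{jk}X^jY^k$ given by a $(1,2)$-tensor field $c$ satisfying the Hertling–Manin condition: for all vector fields $X,Y,Z,W$, $$[X\circ Y,Z\circ W]-[X\circ Y,Z]\circ W-[X\circ Y,W]\circ Z-X\circ[Y,Z\circ W]+X\circ[Y,Z]\circ W+X\circ[Y,W]\circ Z-Y\circ[X,Z\circ W]+Y\circ[X,Z]\circ W+Y\circ[X,W]\circ Z=0 .$$ No unit is assumed. Two systems of hydrodynamic type $u^i_t=V^i_j(u)u^j_x$, $u^i_\tau=W^i_j(u)u^j_x$ commute if $\partial_\tau\partial_t u^i=\partial_t\partial_\tau u^i$ for all $i$, where both sides are computed by the chain rule from the two systems and the equality holds identically in $u,u_x,u_{xx}$. *)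

(* Defs.v *)
From HB Require Import structures.
From mathcomp Require Import all_boot all_order all_algebra.
From mathcomp Require Import all_classical all_reals all_analysis.
Set Implicit Arguments.
Unset Strict Implicit.
Unset Printing Implicit Defensive.
Import Order.TTheory GRing.Theory Num.Theory.
Import numFieldNormedType.Exports.
Local Open Scope classical_set_scope.
Local Open Scope ring_scope.

Section Calculus.
Variables (R : realType) (n : nat).

(* Only the germ of [f] at the point matters: functions given on an open set
   are represented by total functions with irrelevant values outside it. *)
Definition pderiv (i : 'I_n) (f : 'rV[R]_n -> R) : 'rV[R]_n -> R :=
  fun u => 'D_(delta_mx 0 i) f u.

(* C^oo on an open set [D]: Frechet differentiability of every iterated partial
   derivative on [D] makes all of them continuous there; conversely the iterated
   partials of a C^oo function are C^1, hence Frechet differentiable. *)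
Definition smooth_on (D : set 'rV[R]_n) (f : 'rV[R]_n -> R) : Prop :=
  forall (s : seq 'I_n) (u : 'rV[R]_n), D u -> differentiable (foldr pderiv f s) u.

End Calculus.

(* The values of [cmap] off [cdom] and of [cinv] off [cmap @` cdom] are
   irrelevant. *)
Record chart (R : realType) (n : nat) (T : topologicalType) := Chart {
  cdom : set T;
  cmap : T -> 'rV[R]_n;
  cinv : 'rV[R]_n -> T;
  cdom_open : open cdom;
  cimg_open : open (cmap @` cdom);
  cmapK : forall x, cdom x -> cinv (cmap x) = x;
  cmap_continuous : forall x, cdom x -> {for x, continuous cmap};
  cinv_continuous : forall x, cdom x -> {for cmap x, continuous cinv} }.

Definition cimg (R : realType) (n : nat) (T : topologicalType) (k : chart R n T)
  : set 'rV[R]_n := cmap k @` cdom k.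

(* Any smooth atlas is allowed, in particular a maximal one. *)
Record manifold (R : realType) (n : nat) := Manifold {
  carrier :> topologicalType;
  chart_index : Type;
  atlas : chart_index -> chart R n carrier;
  manifold_hausdorff : hausdorff_space carrier;
  manifold_second_countable : @second_countable carrier;
  atlas_cover : forall x : carrier, exists a, cdom (atlas a) x;
  atlas_smooth : forall (a b : chart_index) (i : 'I_n),
    smooth_on (cmap (atlas a) @` (cdom (atlas a) `&` cdom (atlas b)))
              (fun u => cmap (atlas b) (cinv (atlas a) u) 0 i) }.

Section Tensors.
Variables (R : realType) (n : nat) (M : manifold R n).
Implicit Types (a b : chart_index M).

(* [jac a b u i j] is du_b^i / du_a^j at the point with a-coordinates [u]. *)
Definition jac a b (u : 'rV[R]_n) (i j : 'I_n) : R :=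
  pderiv j (fun v => cmap (atlas b) (cinv (atlas a) v) 0 i) u.

(* [hess a b u i j k] is d^2 u_b^i / du_a^j du_a^k. *)
Definition hess a b (u : 'rV[R]_n) (i j k : 'I_n) : R :=
  pderiv j (fun v => jac a b v i k) u.

(* Contravariant components in every chart, as functions of the coordinates;
   only the values of the a-th family on [cimg (atlas a)] are meaningful. *)
Definition components : Type := chart_index M -> 'rV[R]_n -> 'rV[R]_n.

Definition eq_components (X Y : components) : Prop :=
  forall a u, cimg (atlas a) u -> X a u = Y a u.

Record vector_field := VectorField {
  vf :> components;
  vf_smooth : forall a (i : 'I_n),
    smooth_on (cimg (atlas a)) (fun u => vf a u 0 i);
  vf_transform : forall a b (x : M), cdom (atlas a) x -> cdom (atlas b) x ->
    forall i : 'I_n, vf b (cmap (atlas b) x) 0 i =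
      \sum_(j < n) jac a b (cmap (atlas a) x) i j * vf a (cmap (atlas a) x) 0 j }.

(* [tensor12_comp c a u i j k] is c^i_{jk}. *)
Record tensor12 := Tensor12 {
  tensor12_comp :> chart_index M -> 'rV[R]_n -> 'I_n -> 'I_n -> 'I_n -> R;
  tensor12_smooth : forall a (i j k : 'I_n),
    smooth_on (cimg (atlas a)) (fun u => tensor12_comp a u i j k);
  tensor12_transform : forall a b (x : M),
    cdom (atlas a) x -> cdom (atlas b) x ->
    let u := cmap (atlas a) x in let v := cmap (atlas b) x in
    forall i j k : 'I_n, tensor12_comp b v i j k =
      \sum_(l < n) \sum_(m < n) \sum_(r < n)
        jac a b u i l * jac b a v m j * jac b a v r k * tensor12_comp a u l m r }.

(* Affine connection given by its Christoffel symbols: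
   [christoffel a u i j k] is Gamma^i_{jk}, where
   nabla_{d_j} d_k = Gamma^i_{jk} d_i. *)
Record connection := Connection {
  christoffel : chart_index M -> 'rV[R]_n -> 'I_n -> 'I_n -> 'I_n -> R;
  christoffel_smooth : forall a (i j k : 'I_n),
    smooth_on (cimg (atlas a)) (fun u => christoffel a u i j k);
  christoffel_transform : forall a b (x : M),
    cdom (atlas a) x -> cdom (atlas b) x ->
    let u := cmap (atlas a) x in let v := cmap (atlas b) x in
    forall i j k : 'I_n, christoffel b v i j k =
      \sum_(l < n) jac a b u i l *
        (\sum_(m < n) \sum_(r < n)
           jac b a v m j * jac b a v r k * christoffel a u l m r
         + hess b a v l j k) }.

Definition addc (X Y : components) : components := fun a u => X a u + Y a u.

Definition subc (X Y : components) : components := fun a u => X a u - Y a u.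

Definition zeroc : components := fun _ _ => 0.

Definition lie_bracket (X Y : components) : components := fun a u =>
  \row_i \sum_(j < n) (X a u 0 j * pderiv j (fun v => Y a v 0 i) u
                     - Y a u 0 j * pderiv j (fun v => X a v 0 i) u).

Definition circ (c : tensor12) (X Y : components) : components := fun a u =>
  \row_i \sum_(j < n) \sum_(k < n) c a u i j k * X a u 0 j * Y a u 0 k.

Definition nabla (G : connection) (X Y : components) : components := fun a u =>
  \row_i \sum_(j < n) X a u 0 j *
    (pderiv j (fun v => Y a v 0 i) u
     + \sum_(k < n) christoffel G a u i j k * Y a u 0 k).

(* (nabla_X c)(Y, Z) *)
Definition nabla_tensor (G : connection) (c : tensor12) (X Y Z : components)
  : components :=
  subc (subc (nabla G X (circ c Y Z)) (circ c (nabla G X Y) Z))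
       (circ c Y (nabla G X Z)).

Definition torsionless (G : connection) : Prop :=
  forall X Y : vector_field,
    eq_components (subc (nabla G X Y) (nabla G Y X)) (lie_bracket X Y).

Local Infix "+" := addc.
Local Infix "-" := subc.

Definition hertling_manin (c : tensor12) : Prop :=
  let o := circ c in
  let br := lie_bracket in
  forall X Y Z W : vector_field,
    eq_components
      (br (o X Y) (o Z W) - o (br (o X Y) Z) W - o (br (o X Y) W) Z
       - o X (br Y (o Z W)) + o X (o (br Y Z) W) + o X (o (br Y W) Z)
       - o Y (br X (o Z W)) + o Y (o (br X Z) W) + o Y (o (br X W) Z))
      zeroc.

Record F_manifold (c : tensor12) : Prop := FManifold {
  F_comm : forall X Y : vector_field, eq_components (circ c X Y) (circ c Y X);
  F_assoc : forall X Y Z : vector_field,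
    eq_components (circ c (circ c X Y) Z) (circ c X (circ c Y Z));
  F_hertling_manin : hertling_manin c }.

End Tensors.

Section HydrodynamicType.
Variables (R : realType) (n : nat).

(* u, u_x and u_xx are independent variables, written [u], [p] and [q]. *)

(* The right-hand side V^i_j(u) u^j_x, with [V u i j] for V^i_j(u). *)
Definition hydro (V : 'rV[R]_n -> 'I_n -> 'I_n -> R) (i : 'I_n)
  (u p : 'rV[R]_n) : R := \sum_(j < n) V u i j * p 0 j.

(* d/dx of f(u, u_x). *)
Definition total_x (f : 'rV[R]_n -> 'rV[R]_n -> R) (u p q : 'rV[R]_n) : R :=
  \sum_(l < n) (pderiv l (fun v => f v p) u * p 0 l
              + pderiv l (f u) p * q 0 l).

(* d/dt of f(u, u_x) along u^l_t = F^l(u, u_x), so that u^l_{xt} is the total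
   x-derivative of F^l. *)
Definition total_t (F : 'I_n -> 'rV[R]_n -> 'rV[R]_n -> R)
  (f : 'rV[R]_n -> 'rV[R]_n -> R) (u p q : 'rV[R]_n) : R :=
  \sum_(l < n) (pderiv l (fun v => f v p) u * F l u p
              + pderiv l (f u) p * total_x (F l) u p q).

Definition flows_commute (D : set 'rV[R]_n)
  (V W : 'rV[R]_n -> 'I_n -> 'I_n -> R) : Prop :=
  forall (i : 'I_n) (u p q : 'rV[R]_n), D u ->
    total_t (hydro W) (hydro V i) u p q = total_t (hydro V) (hydro W i) u p q.

End HydrodynamicType.

(* Main.v *)
Require Import Defs.
From HB Require Import structures.
From mathcomp Require Import all_boot all_order all_algebra.
From mathcomp Require Import all_classical all_reals all_analysis.
From mathcomp Require Import ring lra.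
Set Implicit Arguments.
Unset Strict Implicit.
Unset Printing Implicit Defensive.
Import Order.TTheory GRing.Theory Num.Theory.
Import numFieldNormedType.Exports.
Local Open Scope classical_set_scope.
Local Open Scope ring_scope.

(** The theorem is local, so it is an identity between the values and first
derivatives, at one point of a chart, of the components of [c], [X] and [Y].

_The identity._ Write [p = u_x], [q = u_xx] and let [o] be the product at the
point. The chain rule gives the mixed derivative of [u] along the two flows as
[(D_(p o Y) c)(p, X) + p o D_(p o Y) X
   + ((D_p c)(p, Y) + p o D_p Y + q o Y) o X], with [D] the coordinate derivative
([total_t_hydro]). Replacing [D] by the connection [nabla] produces only terms
symmetric in [X] and [Y], because the Christoffel symbols are symmetric
([second_flow_derivative_cov]). The assumption on [X] rewrites
[p o nabla_(p o Y) X] as [(p o nabla_p X) o Y], which matches the term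
[(p o nabla_p X) o Y] of the opposite order of differentiation; likewise for [Y].
With [S (z, x, y) = (nabla_z c)(x, y)], what remains is
[S (p o Y, p, X) + S (p, p, Y) o X = S (p o X, p, Y) + S (p, p, X) o Y].
Since [S] is totally symmetric (commutativity of the product and the assumption
on [nabla c]), this is the covariant derivative along [p] of the associativity
law for [X], [p], [Y] ([second_flow_derivativeC]).

_From global fields to a point._ The hypotheses quantify over vector fields on
[M], so the identities for arbitrary vectors at a point require global fields
with a prescribed value there. They are built with bump functions
([exists_field_with_jet]); choosing the derivative to vanish at the point
isolates the Christoffel symbols and the derivatives of [c]. *)

(** * Directional derivatives *)

Section LocalDifferentiability.
Variables (R : realType) (V W : normedModType R).
Implicit Types f g : V -> W.

(** The expansion of [f] at [x], with the same linear part, also expands [g]. *)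
Lemma near_eq_differentiable f g (x : V) :
  {near x, f =1 g} -> differentiable f x -> differentiable g x.
Proof.
move=> fg df.
have gx : g x = f x by rewrite (nbhs_singleton fg).
have gE : g \o shift x = cst (g x) + 'd f x +o_ 0 id.
  apply/eqaddoP => _/posnumP[e].
  have := diff_locally df; move/eqaddoP => /(_ e%:num (gt0 e)) fo.
  have fg0 : \forall h \near 0, f (h + x) = g (h + x).
    by move: fg; rewrite (near_shift 0 x); apply: filterS => h /=; rewrite subr0.
  near=> h.
  have <- : (f \o shift x - (cst (f x) + 'd f x)) h
    = (g \o shift x - (cst (g x) + 'd f x)) h.
    by rewrite !fctE /= gx; congr (_ - _); near: h.
  by near: h.
have dgE := diff_unique (diff_continuous df) gE.
by apply/diff_locallyP; rewrite dgE; split => //; exact: diff_continuous.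
Unshelve. all: by end_near. Qed.

End LocalDifferentiability.

Section DirectionalDerivatives.
Variables (R : realType) (n : nat).
Implicit Types (f g : 'rV[R]_n -> R).
Implicit Types (h : 'rV[R]_n -> 'rV[R]_n) (D : set 'rV[R]_n).

Lemma derive_pderiv f (u z : 'rV[R]_n) : differentiable f u ->
  'D_z f u = \sum_(i < n) z 0 i * pderiv i f u.
Proof.
move=> df; rewrite deriveE // [in LHS](row_sum_delta z) raddf_sum /=.
apply: eq_bigr => i _.
by rewrite linearZ /= /pderiv deriveE.
Qed.

Lemma pderiv_near i f g (u : 'rV[R]_n) : {near u, f =1 g} ->
  pderiv i f u = pderiv i g u.
Proof. exact: near_eq_derive. Qed.

Lemma pderiv_eq_on D i f g (u : 'rV[R]_n) : open D -> D u ->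
  (forall v, D v -> f v = g v) -> pderiv i f u = pderiv i g u.
Proof.
move=> oD Du fg; apply: pderiv_near.
by apply: filterS (open_nbhs_nbhs (conj oD Du)) => v /fg.
Qed.

Lemma differentiable_row h (u : 'rV[R]_n) :
  (forall j, differentiable (fun v => h v 0 j) u) -> differentiable h u.
Proof.
move=> dh.
have -> : h = \sum_(j < n) (fun v => h v 0 j *: (delta_mx 0 j : 'rV[R]_n)).
  by apply/funext => v; rewrite fct_sumE; exact: row_sum_delta.
by apply: differentiable_sum => j; exact: differentiableZl.
Qed.

Lemma derive_row h (u z : 'rV[R]_n) :
  (forall j, differentiable (fun v => h v 0 j) u) ->
  'D_z h u = \row_j 'D_z (fun v => h v 0 j) u.
Proof.
move=> dh; rewrite derive_mx; last exact/diff_derivable/differentiable_row.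
by apply/matrixP => i j; rewrite !mxE ord1.
Qed.

Lemma pderiv_comp i f h (u : 'rV[R]_n) : differentiable f (h u) ->
  (forall j, differentiable (fun v => h v 0 j) u) ->
  pderiv i (f \o h) u =
  \sum_(j < n) pderiv j f (h u) * pderiv i (fun v => h v 0 j) u.
Proof.
move=> df dh; have dh' := differentiable_row dh.
have -> : pderiv i (f \o h) u = 'D_('D_(delta_mx 0 i) h u) f (h u).
  rewrite (deriveE _ df) (deriveE _ dh').
  rewrite /pderiv (deriveE _ (differentiable_comp dh' df)).
  exact: (congr1 (fun F : 'rV[R]_n -> R => F (delta_mx 0 i)) (diff_comp dh' df)).
rewrite (derive_pderiv _ df) (derive_row _ dh).
by apply: eq_bigr => j _; rewrite mxE mulrC.
Qed.

Lemma pderiv_coord i j (u : 'rV[R]_n) :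
  pderiv i (fun v : 'rV[R]_n => v 0 j) u = (i == j)%:R.
Proof.
have := @derive_row id u (delta_mx 0 i).
move=> /(_ (fun j => @differentiable_coord _ _ _ _ _ _)).
by rewrite derive_id => /rowP /(_ j); rewrite !mxE eqxx eq_sym /pderiv => <-.
Qed.

Lemma differentiable_sumf m (F : 'I_m -> 'rV[R]_n -> R) (u : 'rV[R]_n) :
  (forall i, differentiable (F i) u) ->
  differentiable (fun v => \sum_(i < m) F i v) u.
Proof.
move=> dF; have -> : (fun v => \sum_(i < m) F i v) = \sum_(i < m) F i.
  by apply/funext => v; rewrite fct_sumE.
exact: differentiable_sum.
Qed.

Lemma derive_sumf m (F : 'I_m -> 'rV[R]_n -> R) (u z : 'rV[R]_n) :
  (forall i, differentiable (F i) u) ->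
  'D_z (fun v => \sum_(i < m) F i v) u = \sum_(i < m) 'D_z (F i) u.
Proof.
move=> dF; have -> : (fun v => \sum_(i < m) F i v) = \sum_(i < m) F i.
  by apply/funext => v; rewrite fct_sumE.
by apply: derive_sum => i; exact: diff_derivable.
Qed.

Lemma pderivD i f g u : differentiable f u -> differentiable g u ->
  pderiv i (fun v => f v + g v) u = pderiv i f u + pderiv i g u.
Proof. by move=> df dg; apply: deriveD; exact: diff_derivable. Qed.

Lemma pderivM i f g u : differentiable f u -> differentiable g u ->
  pderiv i (fun v => f v * g v) u = f u * pderiv i g u + g u * pderiv i f u.
Proof. by move=> df dg; apply: deriveM; exact: diff_derivable. Qed.

End DirectionalDerivatives.

(** * Closure properties of smooth functions *)

Section SmoothFunctions.
Variables (R : realType) (n : nat).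
Implicit Types (f g : 'rV[R]_n -> R).
Implicit Types (h : 'rV[R]_n -> 'rV[R]_n) (D : set 'rV[R]_n).

(** [smooth_on] cut off at order [k]; the closure properties below hold for
    each [k], by induction on it, because the Leibniz and chain rules express
    a partial derivative through functions of one order less. *)
Fixpoint k_smooth (k : nat) D f : Prop :=
  (forall u, D u -> differentiable f u) /\
  (if k is k'.+1 then forall i, k_smooth k' D (pderiv i f) else True).

Lemma smooth_onP D f : smooth_on D f <-> forall k, k_smooth k D f.
Proof.
split=> [sf k|kf s u Du].
  elim: k f sf => [|k IHk] f sf; split => //; try exact: (sf [::]).
  by move=> i; apply: IHk => s u Du; have := sf (rcons s i) u Du;
    rewrite foldr_rcons.
have [k sk] : exists k, (size s <= k)%N by exists (size s).
elim/last_ind: s k f {kf} (kf k) sk => [|s i IHs] k f kf sk /=.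
  by case: k kf {sk} => [|k] [] + _; exact.
rewrite foldr_rcons; rewrite size_rcons in sk; case: k kf sk => [//|k] [_ kf] sk.
exact: IHs (kf i) sk.
Qed.

Lemma k_smooth_differentiable k D f u : k_smooth k D f -> D u -> differentiable f u.
Proof. by case: k => [|k] [] + _; exact. Qed.

Lemma k_smoothW k D f : k_smooth k.+1 D f -> k_smooth k D f.
Proof.
elim: k f => [|k IHk] f [df kf]; split => // i.
exact/IHk/kf.
Qed.

Lemma k_smooth_eq k D f g : open D -> (forall v, D v -> f v = g v) ->
  k_smooth k D f -> k_smooth k D g.
Proof.
move=> oD; elim: k f g => [|k IHk] f g fg [df kf]; split.
1,3: move=> u Du; apply: near_eq_differentiable (df u Du).
1,2: by apply: filterS (open_nbhs_nbhs (conj oD Du)) => v /fg.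
  by [].
move=> i; apply: IHk (kf i) => v Dv.
exact: pderiv_eq_on oD Dv fg.
Qed.

Lemma k_smooth_cst k D a : k_smooth k D (fun=> a).
Proof.
elim: k a => [|k IHk] a; split => //; try by move=> u _; exact: differentiable_cst.
move=> i; have -> : pderiv i (fun=> a) = (fun=> 0) :> ('rV[R]_n -> R).
  by apply/funext => u; exact: derive_cst.
exact: IHk.
Qed.

Lemma k_smoothD k D f g : open D -> k_smooth k D f -> k_smooth k D g ->
  k_smooth k D (fun v => f v + g v).
Proof.
move=> oD; elim: k f g => [|k IHk] f g [df kf] [dg kg]; split => //.
1,2: by move=> u Du; apply: differentiableD; [exact: df|exact: dg].
move=> i; apply: k_smooth_eq oD _ (IHk _ _ (kf i) (kg i)) => v Dv.
by rewrite pderivD //; [exact: df|exact: dg].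
Qed.

Lemma k_smoothM k D f g : open D -> k_smooth k D f -> k_smooth k D g ->
  k_smooth k D (fun v => f v * g v).
Proof.
move=> oD; elim: k f g => [|k IHk] f g sf sg.
all: have [df kf] := sf; have [dg kg] := sg; split => //.
1,2: by move=> u Du; apply: differentiableM; [exact: df|exact: dg].
move=> i.
have := k_smoothD oD (IHk _ _ (k_smoothW sf) (kg i)) (IHk _ _ (k_smoothW sg) (kf i)).
apply: k_smooth_eq => // v Dv.
by rewrite pderivM //; [exact: df|exact: dg].
Qed.

Lemma k_smooth_sum k D (I : Type) (r : seq I) (F : I -> 'rV[R]_n -> R) : open D ->
  (forall i, k_smooth k D (F i)) -> k_smooth k D (fun v => \sum_(i <- r) F i v).
Proof.
move=> oD sF; elim: r => [|i r IHr].
  by apply: k_smooth_eq (k_smooth_cst k D 0) => // v _; rewrite big_nil.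
by apply: k_smooth_eq (k_smoothD oD (sF i) IHr) => // v _; rewrite big_cons.
Qed.

Lemma k_smooth_comp k D E f h : open D -> (forall v, D v -> E (h v)) ->
  k_smooth k E f -> (forall j, k_smooth k D (fun v => h v 0 j)) ->
  k_smooth k D (f \o h).
Proof.
move=> oD hE; elim: k f => [|k IHk] f sf sh.
all: have [df kf] := sf; split => //.
1,2: move=> u Du; apply: differentiable_comp; last exact/df/hE.
1,2: by apply: differentiable_row => j; exact: k_smooth_differentiable (sh j) Du.
move=> i.
have /(k_smooth_sum (index_enum _) oD) : forall j : 'I_n, k_smooth k D
    (fun v => (pderiv j f \o h) v * pderiv i (fun v => h v 0 j) v).
  move=> j; apply: k_smoothM oD _ _; last by case: (sh j) => _; exact.
  by apply: IHk (kf j) _ => j'; exact/k_smoothW/sh.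
apply: k_smooth_eq => // v Dv; rewrite pderiv_comp //; first exact/df/hE.
by move=> j; exact: k_smooth_differentiable (sh j) Dv.
Qed.

Lemma smooth_on_differentiable D f u : smooth_on D f -> D u -> differentiable f u.
Proof. exact: (fun sf => sf [::] u). Qed.

Lemma smooth_on_pderiv D i f : smooth_on D f -> smooth_on D (pderiv i f).
Proof. by move=> sf s u Du; rewrite -(foldr_rcons (@pderiv R n)); exact: sf. Qed.

Lemma smooth_on_subset D E f : D `<=` E -> smooth_on E f -> smooth_on D f.
Proof. by move=> DE sf s u /DE; exact: sf. Qed.

Lemma smooth_on_eq D f g : open D -> (forall v, D v -> f v = g v) ->
  smooth_on D f -> smooth_on D g.
Proof.
by move=> oD fg /smooth_onP sf; apply/smooth_onP => k; exact: k_smooth_eq (sf k).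
Qed.

Lemma smooth_on_cst D a : smooth_on D (fun=> a).
Proof. by apply/smooth_onP => k; exact: k_smooth_cst. Qed.

Lemma smooth_on_coord D i : smooth_on D (fun v : 'rV[R]_n => v 0 i).
Proof.
apply/smooth_onP => -[|k]; split => //.
1,2: by move=> u _; exact: differentiable_coord.
move=> j; have -> : pderiv j (fun v : 'rV[R]_n => v 0 i) = (fun=> (j == i)%:R).
  by apply/funext => u; exact: pderiv_coord.
exact: k_smooth_cst.
Qed.

Lemma smooth_onM D f g : open D -> smooth_on D f -> smooth_on D g ->
  smooth_on D (fun v => f v * g v).
Proof.
move=> oD /smooth_onP sf /smooth_onP sg.
by apply/smooth_onP => k; exact: k_smoothM.
Qed.

Lemma smooth_onD D f g : open D -> smooth_on D f -> smooth_on D g ->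
  smooth_on D (fun v => f v + g v).
Proof.
move=> oD /smooth_onP sf /smooth_onP sg.
by apply/smooth_onP => k; exact: k_smoothD.
Qed.

Lemma smooth_on_sum D (I : Type) (r : seq I) (F : I -> 'rV[R]_n -> R) : open D ->
  (forall i, smooth_on D (F i)) -> smooth_on D (fun v => \sum_(i <- r) F i v).
Proof.
move=> oD sF; apply/smooth_onP => k; apply: k_smooth_sum => // i.
by move: (sF i) => /smooth_onP; exact.
Qed.

Lemma smooth_on_comp D E f h : open D -> (forall v, D v -> E (h v)) ->
  smooth_on E f -> (forall j, smooth_on D (fun v => h v 0 j)) ->
  smooth_on D (f \o h).
Proof.
move=> oD hE /smooth_onP sf sh; apply/smooth_onP => k.
by apply: k_smooth_comp hE (sf k) _ => // j; move: (sh j) => /smooth_onP; exact.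
Qed.

End SmoothFunctions.

(** * Bump functions *)

Section FlatFunctions.
Variable R : realType.
Implicit Types (t : R) (k : nat).

(** The functions [t ^- k * exp (- 1 / t)], extended by [0]: this family,
    unlike [exp (- 1 / t)] alone, is closed under differentiation up to linear
    combinations. *)
Definition flat k t : R := if 0 < t then t ^- k * expR (- t^-1) else 0.

Lemma flat_le0 k t : t <= 0 -> flat k t = 0.
Proof. by rewrite /flat ltNge => ->. Qed.

Lemma flat_gt0 t : 0 < t -> 0 < flat 0 t.
Proof. by move=> t0; rewrite /flat t0 expr0 invr1 mul1r expR_gt0. Qed.

(** The exponential beats every power; an exponent above [1] is what makes the
    derivative at the origin vanish. *)
Lemma flat_bound k t : `|flat k t| <= (k.+2)`!%:R * t ^+ 2.
Proof.
rewrite /flat; case: ltP => [t0|_]; last first.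
  by rewrite normr0 mulr_ge0 // sqr_ge0.
have tk (m : nat) : 0 < t ^+ m by exact: exprn_gt0.
have t1 : 0 <= t^-1 by rewrite invr_ge0 ltW.
have fk : 0 < (k.+2)`!%:R :> R by rewrite ltr0n fact_gt0.
have ftk : 0 < (k.+2)`!%:R * t ^+ k.+2 by exact: mulr_gt0.
have eb : expR (- t^-1) <= (k.+2)`!%:R * t ^+ k.+2.
  rewrite expRN -[leRHS]invrK lef_pV2 ?posrE ?invr_gt0 ?ftk ?expR_gt0 //.
  by rewrite invfM mulrC -exprVn (le_trans _ (expR_ge1Dxn k.+1 t1)) // lerDr.
rewrite ger0_norm; last by rewrite mulr_ge0 ?expR_ge0 // invr_ge0 ltW.
apply: (le_trans (ler_wpM2l _ eb)); first by rewrite invr_ge0 ltW.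
by rewrite mulrCA -[k.+2]addn2 exprD mulKf ?gt_eqF.
Qed.

Lemma is_derive_flat k t :
  is_derive t 1 (flat k) (flat k.+2 t - k%:R * flat k.+1 t).
Proof.
have [t0|t0|->] := ltgtP t 0.
- rewrite !flat_le0 ?ltW // mulr0 subr0.
  apply: near_eq_is_derive (is_derive_cst 0 t 1).
  near=> s; rewrite flat_le0 // ltW //; near: s; exact: lt_nbhsl.
- apply: (@near_eq_is_derive R R^o R^o (fun s => s ^- k * expR (- s^-1))).
    near=> s; rewrite /flat ifT //; near: s; exact: lt_nbhsr.
  have tn0 : t != 0 by rewrite gt_eqF.
  have tkn0 : t ^+ k != 0 by rewrite expf_neq0.
  have dk : is_derive t 1 (fun s : R => s ^- k)
      (- (t ^+ k) ^- 2 *: (k%:R * t ^+ k.-1)).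
    apply: is_deriveV => //.
    have := @is_deriveX R R^o id k t 1 1 _.
    rewrite exprfctE /= [_ *: 1]mulr1; exact.
  have de : is_derive t 1 (fun s : R => expR (- s^-1))
      (expR (- t^-1) * t ^- 2).
    apply: (@is_derive1_comp R expR (fun s => - s^-1)).
    have := is_deriveN (is_deriveV tn0 (is_derive_id t 1)).
    by rewrite scaleNr opprK [_ *: 1]mulr1; exact.
  apply: (@is_derive_eq R R^o R^o _ _ _ _ _
    (is_deriveM dk de)).
  rewrite /flat t0 /GRing.scale /=.
  case: (k) tkn0 => [_|m tm]; rewrite /= !exprS ?expr0; field => //.
  by rewrite expf_neq0.

- rewrite !flat_le0 // mulr0 subr0.
  have cv : h^-1 *: ((flat k \o shift 0) (h *: 1) - flat k 0)
      @[h --> 0^'] --> (0 : R).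
    apply/cvgr0Pnorm_le => e e0.
    pose C : R := (k.+2)`!%:R.
    have C0 : 0 < C by rewrite ltr0n fact_gt0.
    near=> h.
    rewrite /= addr0 [h *: 1]mulr1 (flat_le0 k (lexx 0)) subr0 normrM normfV.
    have h0 : 0 < `|h| by rewrite normr_gt0; near: h; exact: nbhs_dnbhs_neq.
    rewrite mulrC ler_pdivrMr // (le_trans (flat_bound _ _)) //.
    rewrite -real_normK ?num_real // expr2 mulrA ler_wpM2r // mulrC -ler_pdivlMr //.
    by near: h; apply: dnbhs0_le; rewrite divr_gt0.
  by apply: DeriveDef; [exact: cvgP cv|exact: cvg_lim cv].
Unshelve. all: by end_near. Qed.

End FlatFunctions.

Section BumpFunctions.
Variables (R : realType) (n : nat).
Implicit Types (q : 'rV[R]_n -> R) (D : set 'rV[R]_n).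

Lemma differentiable_flat_comp k q u :
  differentiable q u -> differentiable (flat k \o q) u.
Proof.
move=> dq; apply: differentiable_comp => //.
by apply/derivable1_diffP; have [] := is_derive_flat k (q u).
Qed.

Lemma pderiv_flat_comp k q u i : differentiable q u ->
  pderiv i (flat k \o q) u =
  (flat k.+2 (q u) + - k%:R * flat k.+1 (q u)) * pderiv i q u.
Proof.
move=> dq; have [/derivable1_diffP df dfE] := is_derive_flat k (q u).
rewrite /pderiv (deriveE _ (differentiable_comp dq df)).
transitivity ('d (flat k) (q u) ('d q u (delta_mx 0 i))).
  exact: (congr1 (fun F : 'rV[R]_n -> R => F (delta_mx 0 i)) (diff_comp dq df)).
rewrite -(deriveE _ dq) diff1E // derive1E dfE.
by rewrite mulNr [RHS]mulrC.
Qed.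

(** The induction on the order of derivation is uniform in [k], since
    differentiating raises [k]. *)
Lemma smooth_on_flat_comp D k q : open D -> smooth_on D q ->
  smooth_on D (flat k \o q).
Proof.
move=> oD /smooth_onP sq; apply/smooth_onP => m.
elim: m k => [|m IHm] k; split => //.
1,2: move=> u Du; apply: differentiable_flat_comp.
1,2: exact: k_smooth_differentiable (sq 0%N) Du.
move=> i.
have sqi : k_smooth m D (pderiv i q) by case: (sq m.+1) => _; exact.
have := k_smoothM oD (k_smoothD oD (IHm k.+2)
  (k_smoothM oD (k_smooth_cst m D (- k%:R)) (IHm k.+1))) sqi.
apply: k_smooth_eq => // u Du; rewrite pderiv_flat_comp //.
exact: k_smooth_differentiable (sq 0%N) Du.
Qed.

(** Besides the value [1], the vanishing of the differential at the centre is
    required: multiplying by such a function leaves the 1-jet unchanged. *)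
Lemma exists_bump (a : 'rV[R]_n) (r : R) : 0 < r ->
  exists phi : 'rV[R]_n -> R,
    [/\ smooth_on setT phi, phi a = 1, forall i, pderiv i phi a = 0 &
      forall u, r < `|a - u| -> phi u = 0].
Proof.
move=> r0.
(* [q] is [r ^ 2] minus the squared Euclidean distance to [a]; as a product of
   two factors vanishing at [a], each [d j] has zero differential there. *)
pose d (j : 'I_n) (u : 'rV[R]_n) := (u 0 j - a 0 j) * (a 0 j - u 0 j).
pose q (u : 'rV[R]_n) := r ^+ 2 + \sum_(j < n) d j u.
have sB j : smooth_on setT (fun u : 'rV[R]_n => u 0 j - a 0 j).
  by apply: smooth_onD; [exact: openT|exact: smooth_on_coord|exact: smooth_on_cst].
have sC j : smooth_on setT (fun u : 'rV[R]_n => a 0 j - u 0 j).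
  have := smooth_onM openT (@smooth_on_cst _ _ setT (-1)) (sB j).
  by apply: smooth_on_eq openT _ => u _; rewrite mulN1r opprB.
have sd j : smooth_on setT (d j) by exact: smooth_onM openT (sB j) (sC j).
have ss : smooth_on setT (fun u => \sum_(j < n) d j u).
  by apply: smooth_on_sum => //; exact: openT.
have sq : smooth_on setT q by apply: smooth_onD openT (@smooth_on_cst _ _ _ _) ss.
have qa : q a = r ^+ 2.
  by rewrite /q big1 ?addr0 // => j _; rewrite /d subrr mul0r.
have dqa i : pderiv i q a = 0.
  rewrite pderivD; [|exact: differentiable_cst|]; last first.
    exact: smooth_on_differentiable ss _.
  rewrite {1}/pderiv derive_cst add0r /pderiv derive_sumf; last first.
    by move=> j; exact: smooth_on_differentiable (sd j) _.
  rewrite big1 // => j _; rewrite [LHS]pderivM ?subrr ?mul0r ?addr0 //.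
    exact: smooth_on_differentiable (sB j) _.
  exact: smooth_on_differentiable (sC j) _.
have f0 : 0 < flat 0 (r ^+ 2) by rewrite flat_gt0 // exprn_gt0.
have sf := smooth_on_flat_comp 0 openT sq.
exists (fun u => (flat 0 (r ^+ 2))^-1 * (flat 0 \o q) u); split.
- exact: smooth_onM openT (@smooth_on_cst _ _ _ _) sf.
- by rewrite /= qa mulVf // gt_eqF.
- move=> i; rewrite pderivM; [|exact: differentiable_cst|].
    rewrite [X in _ * X + _]pderiv_flat_comp; last first.
      exact: smooth_on_differentiable sq _.
    by rewrite dqa !mulr0 add0r /pderiv derive_cst mulr0.
  exact: smooth_on_differentiable sf _.
move=> u ru; suff qu : q u <= 0 by rewrite /= (flat_le0 0 qu) mulr0.
rewrite leNgt; apply/negP => q0.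
move: ru; apply/negP; rewrite -leNgt [leLHS]mx_normrE; apply: bigmax_le => [|[i j] _].
  exact: ltW.
have dE k : d k u = - (a 0 k - u 0 k) ^+ 2 by rewrite /d -opprB mulNr expr2.
have r2 : 0 <= r ^+ 2 - (a 0 j - u 0 j) ^+ 2; last first.
  have rn : r \is Num.nneg by rewrite nnegrE ltW.
  have an : `|a 0 j - u 0 j| \is Num.nneg by rewrite nnegrE.
  by rewrite ord1 !mxE /= -(ler_sqr an rn) real_normK ?num_real // -subr_ge0.
rewrite -dE.
apply: (le_trans (ltW q0)); rewrite /q lerD2l (bigD1 j) //= gerDl.
by rewrite sumr_le0 // => k _; rewrite dE oppr_le0 sqr_ge0.
Qed.

End BumpFunctions.

(** * Vector fields with prescribed 1-jet *)

Section ChartCalculus.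
Variables (R : realType) (n : nat) (M : manifold R n).
Implicit Types (a b : chart_index M) (x : M).

Lemma chart_image_open a (U : set M) :
  open U -> open (cmap (atlas a) @` (cdom (atlas a) `&` U)).
Proof.
move=> oU; rewrite openE => _ [x [ax Ux] <-].
have nD : nbhs (cmap (atlas a) x) (cimg (atlas a)).
  by apply: open_nbhs_nbhs; split; [exact: cimg_open|exists x].
have nU : nbhs (cmap (atlas a) x) (cinv (atlas a) @^-1` U).
  apply: (cinv_continuous ax); rewrite (cmapK ax).
  exact: open_nbhs_nbhs.
near=> v; have [y ay yv] : cimg (atlas a) v by near: v.
exists y => //; split => //; rewrite -(cmapK ay) yv; near: v; exact: nU.
Unshelve. all: by end_near. Qed.

Lemma overlap_open a b :
  open (cmap (atlas a) @` (cdom (atlas a) `&` cdom (atlas b))).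
Proof. by apply: chart_image_open; exact: cdom_open. Qed.

Lemma jac_self a v i j : cimg (atlas a) v -> jac a a v i j = (j == i)%:R.
Proof.
move=> av; rewrite /jac -(pderiv_coord j i v).
apply: (pderiv_eq_on j (cimg_open (c := atlas a)) av) => _ [x ax <-].
by rewrite (cmapK ax).
Qed.

Lemma jac_comp a b b' x i j :
  cdom (atlas a) x -> cdom (atlas b) x -> cdom (atlas b') x ->
  jac a b' (cmap (atlas a) x) i j =
  \sum_(k < n) jac b b' (cmap (atlas b) x) i k * jac a b (cmap (atlas a) x) k j.
Proof.
move=> ax bx b'x; set u := cmap (atlas a) x.
pose f w := cmap (atlas b') (cinv (atlas b) w) 0 i.
pose h w := cmap (atlas b) (cinv (atlas a) w).
have hu : h u = cmap (atlas b) x by rewrite /h /u (cmapK ax).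
have Ou : (cmap (atlas a) @` (cdom (atlas a) `&` cdom (atlas b))) u by exists x.
have -> : jac a b' u i j = pderiv j (f \o h) u.
  apply: (pderiv_eq_on j (overlap_open (a := a) (b := b)) Ou) => _ [y [ay b_y] <-].
  by rewrite /f /h /= (cmapK ay) (cmapK b_y).
rewrite pderiv_comp ?hu //.
  by apply: (smooth_on_differentiable (atlas_smooth (a := b) (b := b') i)); exists x.
by move=> k; exact: (smooth_on_differentiable (atlas_smooth (a := a) (b := b) k)).
Qed.

End ChartCalculus.

Section LocalizedFields.
Variables (R : realType) (n : nat) (M : manifold R n).
Variables (a : chart_index M) (phi : 'rV[R]_n -> R) (K : set 'rV[R]_n).
Hypotheses (phi_smooth : smooth_on setT phi) (K_compact : compact K).
Hypotheses (K_chart : K `<=` cimg (atlas a)) (phi0 : forall u, ~ K u -> phi u = 0).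
Variable w : 'rV[R]_n.

(** The components in every chart [b] of the field that is [phi w] in the chart
    [a] and zero outside its domain. *)
Definition localized_components : components M := fun b v =>
  let x := cinv (atlas b) v in
  if `[< cdom (atlas a) x >] then
    \row_i \sum_(j < n) jac a b (cmap (atlas a) x) i j
                        * (phi (cmap (atlas a) x) * w 0 j)
  else 0.

Lemma localized_smooth b i :
  smooth_on (cimg (atlas b)) (fun v => localized_components b v 0 i).
Proof.
move=> s _ [x bx <-]; have [ax|ax] := pselect (cdom (atlas a) x).
  pose O := cmap (atlas b) @` (cdom (atlas b) `&` cdom (atlas a)).
  pose E := cmap (atlas a) @` (cdom (atlas a) `&` cdom (atlas b)).
  have oO : open O by exact: overlap_open.
  have oE : open E by exact: overlap_open.
  suff : smooth_on O (fun v => localized_components b v 0 i) by apply; exists x.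
  pose h v := cmap (atlas a) (cinv (atlas b) v).
  pose f u := \sum_(j < n) jac a b u i j * (phi u * w 0 j).
  have sf : smooth_on E f.
    apply: smooth_on_sum => // j; apply: smooth_onM => //.
      exact/smooth_on_pderiv/atlas_smooth.
    apply: smooth_onM => //; last exact: smooth_on_cst.
    exact: smooth_on_subset phi_smooth.
  have hE v : O v -> E (h v).
    by move=> [y [b_y ay] <-]; exists y => //; rewrite /h (cmapK b_y).
  have sh j : smooth_on O (fun v => h v 0 j) by exact: atlas_smooth.
  apply: smooth_on_eq oO _ (smooth_on_comp oO hE sf sh) => _ [y [b_y ay] <-].
  rewrite /localized_components /f /h /= (cmapK b_y).
  by case: asboolP => // _; rewrite mxE.
(* Outside the chart [a] the field is locally zero, because the support is
   compact in the chart, hence closed in the Hausdorff space [M]. *)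
pose U : set M := ~` (cinv (atlas a) @` K).
have oU : open U.
  rewrite openC; apply: compact_closed; first exact: manifold_hausdorff.
  apply: continuous_compact => //; apply: continuous_in_subspaceT => u.
  by rewrite inE => /K_chart [y ay <-]; exact: cinv_continuous.
pose O := cmap (atlas b) @` (cdom (atlas b) `&` U).
have oO : open O by exact: chart_image_open.
suff : smooth_on O (fun v => localized_components b v 0 i).
  apply; exists x => //; split => // -[u /K_chart [y ay <-]].
  by rewrite (cmapK ay) => yx; apply: ax; rewrite -yx.
apply: smooth_on_eq oO _ (@smooth_on_cst _ _ _ 0) => _ [y [b_y Uy] <-].
rewrite /localized_components /= (cmapK b_y); case: asboolP => ay; last by rewrite mxE.
rewrite mxE big1 // => j _; rewrite phi0 ?mul0r ?mulr0 // => Ky.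
by apply: Uy; exists (cmap (atlas a) y) => //; rewrite (cmapK ay).
Qed.

Lemma localized_transform b b' x : cdom (atlas b) x -> cdom (atlas b') x ->
  forall i, localized_components b' (cmap (atlas b') x) 0 i =
    \sum_(j < n) jac b b' (cmap (atlas b) x) i j *
                 localized_components b (cmap (atlas b) x) 0 j.
Proof.
move=> bx b'x i; rewrite /localized_components /= (cmapK bx) (cmapK b'x).
case: asboolP => ax; last by rewrite mxE big1 // => j _; rewrite mxE mulr0.
rewrite mxE; under [RHS]eq_bigr do rewrite mxE mulr_sumr.
rewrite exchange_big; apply: eq_bigr => k _ /=.
rewrite (jac_comp i k ax bx b'x) mulr_suml.
by apply: eq_bigr => j _; rewrite -mulrA.
Qed.

Definition localized_field : vector_field M :=
  VectorField localized_smooth localized_transform.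

Lemma localized_fieldE u : cimg (atlas a) u ->
  vf localized_field a u = phi u *: w.
Proof.
move=> [x ax <-]; apply/rowP => i.
rewrite /= /localized_components /= (cmapK ax).
case: asboolP => // _; rewrite !mxE (bigD1 i) //= big1 => [|j ji].
  by rewrite jac_self ?eqxx ?mul1r ?addr0 //; exists x.
by rewrite jac_self ?(negbTE ji) ?mul0r //; exists x.
Qed.

End LocalizedFields.

(** This is what turns identities between global vector fields into identities
    between the components of tensors and connections at a point. *)
Lemma exists_field_with_jet (R : realType) (n : nat) (M : manifold R n)
    (a : chart_index M) (u w : 'rV[R]_n) : cimg (atlas a) u ->
  exists Z : vector_field M, vf Z a u = w /\
    forall i j, pderiv j (fun v => vf Z a v 0 i) u = 0.
Proof.
move=> au; have oa : open (cimg (atlas a)) by exact: cimg_open.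
have /nbhs_ballP [e /= e0 eD] := open_nbhs_nbhs (conj oa au).
have r0 : 0 < e / 2 by rewrite divr_gt0.
have [phi [sphi phi1 dphi phi0]] := exists_bump u r0.
pose K := closed_ball_ (@Num.norm R 'rV[R]_n) u (e / 2).
have KD : K `<=` cimg (atlas a).
  move=> v Kv; apply: eD; rewrite -ball_normE /=.
  by rewrite (le_lt_trans Kv) // ltr_pdivrMr // ltr_pMr // ltr1n.
have cK : compact K.
  apply: bounded_closed_compact; last exact: closed_closed_ball_.
  exists (`|u| + e / 2); split; first exact: num_real.
  move=> m um v Kv /=; rewrite (le_trans _ (ltW um)) //.
  rewrite -[v](subKr u) (le_trans (ler_normB _ _)) // lerD2l.
  exact: Kv.
have phiK v : ~ K v -> phi v = 0.
  by move=> /negP; rewrite -ltNge; exact: phi0.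
exists (localized_field sphi cK KD phiK w); split.
  by rewrite localized_fieldE // phi1 scale1r.
move=> i j; rewrite (@pderiv_eq_on _ _ _ _ _ (fun v => phi v * w 0 i) _ oa au).
  rewrite pderivM; last exact: differentiable_cst.
    by rewrite dphi mulr0 addr0 /pderiv derive_cst mulr0.
  exact: smooth_on_differentiable sphi _.
by move=> v av; rewrite localized_fieldE // mxE.
Qed.

(** * Algebra of a product with compatible connection *)

Section FlowAlgebra.
Variables (R : realFieldType) (n : nat).
Local Notation V := 'rV[R]_n.
Variables (mu : V -> V -> V) (D : V -> V -> V -> V) (Ga : V -> V -> V).
Hypotheses (mulC : commutative mu) (mulA : associative mu).
Hypothesis mulDl : forall x y z, mu (x + y) z = mu x z + mu y z.
Hypothesis D_sym : forall z x y, D z x y = D z y x.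
Hypothesis D_assoc : forall z x y w,
  D z (mu x y) w + mu (D z x y) w = D z x (mu y w) + mu x (D z y w).
Hypothesis Ga_sym : commutative Ga.

Let mulDr z x y : mu z (x + y) = mu z x + mu z y.
Proof. by rewrite mulC mulDl !(mulC _ z). Qed.

Let mulNl x y : mu (- x) y = - mu x y.
Proof.
have mul0 : mu 0 y = 0 by apply: (@addrI _ (mu 0 y)); rewrite -mulDl !addr0.
by apply: (@addrI _ (mu x y)); rewrite -mulDl !subrr mul0.
Qed.

Let mulNr x y : mu x (- y) = - mu x y.
Proof. by rewrite mulC mulNl mulC. Qed.

(** [nabla_z c] evaluated on [x] and [y]. *)
Definition cov_mul z x y : V :=
  D z x y + Ga z (mu x y) - mu (Ga z x) y - mu x (Ga z y).

Hypothesis cov_mul_sym : forall x y z, cov_mul x y z = cov_mul y x z.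

Lemma cov_mulC z x y : cov_mul z x y = cov_mul z y x.
Proof.
rewrite /cov_mul D_sym (mulC y x) (mulC (Ga z x)) (mulC x (Ga z y)).
by rewrite addrAC.
Qed.

(** The covariant derivative of associativity: the Christoffel terms act as a
    derivation on both sides and cancel. *)
Lemma cov_mul_assoc z x y w :
  cov_mul z (mu x y) w + mu (cov_mul z x y) w =
  cov_mul z x (mu y w) + mu x (cov_mul z y w).
Proof.
rewrite /cov_mul !mulDl !mulDr !mulNl !mulNr !mulA.
apply/rowP => i; have /rowP /(_ i) := D_assoc z x y w.
rewrite !mxE; lra.
Qed.

Section TwoFields.
Variables (X Y : V) (DX DY : V -> V).
Hypothesis nablaX : forall z w, mu (DX z + Ga z X) w = mu (DX w + Ga w X) z.
Hypothesis nablaY : forall z w, mu (DY z + Ga z Y) w = mu (DY w + Ga w Y) z.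

(** The derivative along the flow of [B] of the right-hand side of the flow of
    [A], where [p] and [q] stand for the first and second space derivatives. *)
Definition second_flow_derivative (A B : V) (DA DB : V -> V) (p q : V) : V :=
  D (mu p B) p A + mu p (DA (mu p B)) + mu (D p p B + mu p (DB p) + mu q B) A.

(** The Christoffel terms left over by covariant differentiation are
    [mu (mu (Ga p p) B) A] and [Ga (mu p B) (mu p A)], both symmetric in [A] and
    [B]. *)
Lemma second_flow_derivative_cov A B DA DB p q :
  second_flow_derivative A B DA DB p q =
  cov_mul (mu p B) p A + mu (cov_mul p p B) A
  + mu p (DA (mu p B) + Ga (mu p B) A) + mu (mu p (DB p + Ga p B)) A
  + mu (mu (Ga p p) B) A + mu (mu q B) A - Ga (mu p B) (mu p A).
Proof.
rewrite /second_flow_derivative /cov_mul !mulDl !mulDr !mulNl !mulDl.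
rewrite (Ga_sym (mu p B) p).
by apply/rowP => i; rewrite !mxE; lra.
Qed.

(** Total symmetry of [cov_mul] turns the non-symmetric part into the
    derivative of associativity along [p] itself. *)
Lemma second_flow_derivativeC p q :
  second_flow_derivative X Y DX DY p q = second_flow_derivative Y X DY DX p q.
Proof.
rewrite !second_flow_derivative_cov.
have hX : mu p (DX (mu p Y) + Ga (mu p Y) X) = mu (mu p (DX p + Ga p X)) Y.
  by rewrite mulC nablaX mulA (mulC p).
have hY : mu p (DY (mu p X) + Ga (mu p X) Y) = mu (mu p (DY p + Ga p Y)) X.
  by rewrite mulC nablaY mulA (mulC p).
have h1 : mu (mu (Ga p p) Y) X = mu (mu (Ga p p) X) Y by rewrite -!mulA (mulC Y).
have h2 : mu (mu q Y) X = mu (mu q X) Y by rewrite -!mulA (mulC Y).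
have S : cov_mul (mu p Y) p X + mu (cov_mul p p Y) X
       = cov_mul (mu p X) p Y + mu (cov_mul p p X) Y.
  rewrite !(cov_mul_sym (mu p _)) (cov_mulC p _ X) (mulC p X) (mulC _ X).
  by rewrite -cov_mul_assoc (cov_mulC p X p).
rewrite hX hY h1 h2 S (Ga_sym (mu p X)).
by rewrite (addrAC _ (mu (mu p (DX p + Ga p X)) Y)).
Qed.

End TwoFields.
End FlowAlgebra.

(** * Leibniz rule for products with variable structure functions *)

Section BilinearProducts.
Variables (R : realType) (n : nat).
Implicit Types (T : 'I_n -> 'I_n -> 'I_n -> R) (u z v w p : 'rV[R]_n).

(** The product with structure constants [T]; with Christoffel symbols for [T],
    the zeroth-order part of the covariant derivative. *)
Definition bil T v w : 'rV[R]_n :=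
  \row_i \sum_(j < n) \sum_(k < n) T i j k * v 0 j * w 0 k.

Definition row_derive z (F : 'rV[R]_n -> 'rV[R]_n) u : 'rV[R]_n :=
  \row_i 'D_z (fun v => F v 0 i) u.

Definition row_differentiable (F : 'rV[R]_n -> 'rV[R]_n) u : Prop :=
  forall i, differentiable (fun v => F v 0 i) u.

Lemma bilDl T x y z : bil T (x + y) z = bil T x z + bil T y z.
Proof.
apply/rowP => i; rewrite !mxE -big_split; apply: eq_bigr => j _ /=.
rewrite -big_split; apply: eq_bigr => k _ /=.
by rewrite mxE mulrDr mulrDl.
Qed.

Lemma bil0l T z : bil T 0 z = 0.
Proof.
by apply/rowP => i; rewrite !mxE big1 // => j _; rewrite big1 // => k _;
  rewrite mxE mulr0 mul0r.
Qed.

Lemma bil0r T z : bil T z 0 = 0.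
Proof.
by apply/rowP => i; rewrite !mxE big1 // => j _; rewrite big1 // => k _;
  rewrite mxE mulr0.
Qed.

Lemma row_derive_cst z w u : row_derive z (fun=> w) u = 0.
Proof. by apply/rowP => i; rewrite !mxE derive_cst. Qed.

Lemma row_derive_id z u : row_derive z id u = z.
Proof.
rewrite -[RHS](derive_id u z) derive_row // => j.
exact: differentiable_coord.
Qed.

Lemma row_derive_eq_on (D : set 'rV[R]_n) (F H : 'rV[R]_n -> 'rV[R]_n) z u :
  open D -> D u -> (forall v, D v -> F v = H v) ->
  row_derive z F u = row_derive z H u.
Proof.
move=> oD Du FH; apply/rowP => i; rewrite !mxE; apply: near_eq_derive.
by apply: filterS (open_nbhs_nbhs (conj oD Du)) => v /FH ->.
Qed.

Variables (c : 'rV[R]_n -> 'I_n -> 'I_n -> 'I_n -> R) (u : 'rV[R]_n).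
Hypothesis dc : forall i j k, differentiable (fun v => c v i j k) u.
Variables F H : 'rV[R]_n -> 'rV[R]_n.
Hypotheses (dF : row_differentiable F u) (dH : row_differentiable H u).

Let differentiable_term i j k :
  differentiable (fun v => c v i j k * F v 0 j * H v 0 k) u.
Proof. by do 2?[apply: differentiableM]; [exact: dc|exact: dF|exact: dH]. Qed.

Lemma differentiable_bil : row_differentiable (fun v => bil (c v) (F v) (H v)) u.
Proof.
move=> i; under eq_fun do rewrite mxE.
by do 2![apply: differentiable_sumf => ?]; exact: differentiable_term.
Qed.

(** The single differentiation formula behind both sides of the argument: applied
    to constant fields it differentiates the laws of the product, applied to
    vector fields it computes [nabla c] and the derivatives of the flows. *)
Lemma row_derive_bil z :
  row_derive z (fun v => bil (c v) (F v) (H v)) u =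
  bil (fun i j k => 'D_z (fun v => c v i j k) u) (F u) (H u)
  + bil (c u) (row_derive z F u) (H u) + bil (c u) (F u) (row_derive z H u).
Proof.
apply/rowP => i; rewrite !mxE; under eq_fun do rewrite mxE.
rewrite derive_sumf => [|j]; last by apply: differentiable_sumf => k.
rewrite -!big_split; apply: eq_bigr => j _ /=.
rewrite derive_sumf // -!big_split; apply: eq_bigr => k _ /=.
have dcF : derivable (fun v => c v i j k * F v 0 j) u z.
  by apply: diff_derivable; apply: differentiableM.
rewrite [LHS](deriveM dcF (diff_derivable (dH k))).
rewrite [X in _ + _ *: X](deriveM (diff_derivable (dc i j k))
  (diff_derivable (dF j))).
rewrite !mxE /GRing.scale /=; ring.
Qed.

End BilinearProducts.

(** * Second derivatives of hydrodynamic flows *)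

Section HydrodynamicFlows.
Variables (R : realType) (n : nat).
Variables (c : 'rV[R]_n -> 'I_n -> 'I_n -> 'I_n -> R) (u : 'rV[R]_n).
Hypothesis dc : forall i j k, differentiable (fun v => c v i j k) u.
Implicit Types (X Y : 'rV[R]_n -> 'rV[R]_n) (p q : 'rV[R]_n).

Local Notation dcu := (fun z i j k => 'D_z (fun v => c v i j k) u).
Local Notation flow X := (fun v i j => \sum_(k < n) c v i j k * X v 0 k).

Lemma hydro_bil X i : hydro (flow X) i = fun v p => bil (c v) p (X v) 0 i.
Proof.
apply/funext => v; apply/funext => p; rewrite /hydro mxE.
apply: eq_bigr => j _; rewrite mulr_suml; apply: eq_bigr => k _.
by rewrite mulrAC.
Qed.

(** Both the total space derivative and the time derivative along another flow
    have this form: [z] and [y] are the variations of [u] and [u_x]. *)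
Lemma hydro_variation X i p (z y : 'rV[R]_n) : row_differentiable X u ->
  \sum_(l < n) (pderiv l (fun v => hydro (flow X) i v p) u * z 0 l
              + pderiv l (hydro (flow X) i u) p * y 0 l) =
  (bil (dcu z) p (X u) + bil (c u) p (row_derive z X u) + bil (c u) y (X u)) 0 i.
Proof.
move=> dX; rewrite hydro_bil big_split /=.
have dcst (w : 'rV[R]_n) v : row_differentiable (fun=> w) v.
  by move=> j; exact: differentiable_cst.
have did v : row_differentiable (@id 'rV[R]_n) v.
  by move=> j; exact: differentiable_coord.
have dccst v : forall i j k, differentiable (fun _ : 'rV[R]_n => c u i j k) v.
  by move=> *; exact: differentiable_cst.
under eq_bigr do rewrite mulrC.
rewrite -(derive_pderiv _ (differentiable_bil dc (dcst p u) dX i)).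
under eq_bigr do rewrite mulrC.
rewrite -(derive_pderiv _ (differentiable_bil (dccst p) (did p) (dcst (X u) p) i)).
have /rowP /(_ i) := row_derive_bil dc (dcst p u) dX z.
rewrite [LHS]mxE => ->.
have /rowP /(_ i) := row_derive_bil (dccst p) (did p) (dcst (X u) p) y.
rewrite [LHS]mxE => ->.
rewrite !row_derive_cst row_derive_id bil0l !bil0r !addr0.
have -> : (fun i j k => 'D_y (fun=> c u i j k) p)
    = (fun _ _ _ => 0) :> ('I_n -> 'I_n -> 'I_n -> R).
  by do 3![apply/funext => ?]; exact: derive_cst.
rewrite [in RHS]mxE; congr (_ + _); rewrite mxE [X in X + _]mxE big1 ?add0r // => j _.
by rewrite big1 // => k _; rewrite !mul0r.
Qed.

Lemma total_t_hydro X Y i p q : row_differentiable X u -> row_differentiable Y u ->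
  total_t (hydro (flow Y)) (hydro (flow X) i) u p q =
  second_flow_derivative (bil (c u)) (fun z => bil (dcu z)) (X u) (Y u)
    (fun z => row_derive z X u) (fun z => row_derive z Y u) p q 0 i.
Proof.
move=> dX dY; rewrite /second_flow_derivative -hydro_variation // /total_t.
apply: eq_bigr => l _; congr (_ * _ + _ * _); first by rewrite hydro_bil.
exact: hydro_variation.
Qed.

End HydrodynamicFlows.

(** * Pointwise form of the geometric hypotheses *)

Section ComponentsAtAPoint.
Variables (R : realType) (n : nat) (M : manifold R n).
Variables (c : tensor12 M) (G : connection M) (a : chart_index M).
Implicit Types (X Y Z W : vector_field M) (u z x y w : 'rV[R]_n).
Local Notation D := (cimg (atlas a)).
Local Notation mu u := (bil (c a u)).
Local Notation dmu u z := (bil (fun i j k => 'D_z (fun v => c a v i j k) u)).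
Local Notation Ga u := (bil (christoffel G a u)).

Let oD : open D. Proof. exact: cimg_open. Qed.

Lemma tensor12_differentiable u : D u ->
  forall i j k, differentiable (fun v => c a v i j k) u.
Proof. by move=> Du i j k; apply: (smooth_on_differentiable _ Du); exact: tensor12_smooth. Qed.

Lemma vf_differentiable X u : D u -> row_differentiable (vf X a) u.
Proof. by move=> Du i; apply: (smooth_on_differentiable _ Du); exact: vf_smooth. Qed.

Lemma nablaE (Z W : components M) u : row_differentiable (W a) u ->
  nabla G Z W a u = row_derive (Z a u) (W a) u + Ga u (Z a u) (W a u).
Proof.
move=> dW; apply/rowP => i; rewrite !mxE derive_pderiv //.
rewrite -big_split; apply: eq_bigr => j _ /=.
rewrite mulrDr mulr_sumr; congr (_ + _); apply: eq_bigr => k _.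
by rewrite mulrA (mulrC (Z a u 0 j)).
Qed.

Lemma exists_stationary_field u w : D u ->
  exists Z, vf Z a u = w /\ forall z, row_derive z (vf Z a) u = 0.
Proof.
move=> Du; have [Z [Zu dZ]] := exists_field_with_jet w Du; exists Z; split=> // z.
apply/rowP => i; rewrite !mxE derive_pderiv; last exact: vf_differentiable Du i.
by rewrite big1 // => j _; rewrite dZ mulr0.
Qed.

Section Product.
Hypothesis hF : F_manifold c.

Lemma product_comm u : D u -> commutative (mu u).
Proof.
move=> Du x y; have [X [<- _]] := exists_stationary_field x Du.
have [Y [<- _]] := exists_stationary_field y Du.
exact: (F_comm hF X Y Du).
Qed.

Lemma product_assoc u : D u -> associative (mu u).
Proof.
move=> Du x y w; have [X [<- _]] := exists_stationary_field x Du.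
have [Y [<- _]] := exists_stationary_field y Du.
have [W [<- _]] := exists_stationary_field w Du.
exact/esym/(F_assoc hF X Y W Du).
Qed.

(** The derivative of the structure functions is that of the product of two
    constant fields; identities of the product can thus be differentiated. *)
Lemma product_derive u z x y : D u ->
  row_derive z (fun v => mu v x y) u = dmu u z x y.
Proof.
move=> Du; rewrite (row_derive_bil (tensor12_differentiable Du)).
- by rewrite !row_derive_cst bil0l bil0r !addr0.
- by move=> i; exact: differentiable_cst.
- by move=> i; exact: differentiable_cst.
Qed.

Lemma product_derive_comm u z x y : D u -> dmu u z x y = dmu u z y x.
Proof.
move=> Du; rewrite -!product_derive //.
by apply: (row_derive_eq_on z oD Du) => v Dv; exact: product_comm.
Qed.

Lemma product_derive_assoc u z x y w : D u ->
  dmu u z (mu u x y) w + mu u (dmu u z x y) w =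
  dmu u z x (mu u y w) + mu u x (dmu u z y w).
Proof.
move=> Du; have dc := tensor12_differentiable Du.
have dcst (v : 'rV[R]_n) : row_differentiable (fun=> v) u.
  by move=> i; exact: differentiable_cst.
have := row_derive_eq_on z oD Du (fun v Dv => product_assoc Dv x y w).
rewrite (row_derive_bil dc (dcst x) (differentiable_bil dc (dcst y) (dcst w))).
rewrite (row_derive_bil dc (differentiable_bil dc (dcst x) (dcst y)) (dcst w)).
by rewrite !row_derive_cst bil0l bil0r !addr0 !product_derive // => ->.
Qed.

End Product.

(** For fields stationary at the point the bracket vanishes there and the
    covariant derivative reduces to its Christoffel part. *)
Lemma christoffel_comm u : torsionless G -> D u -> commutative (Ga u).
Proof.
move=> hG Du x y; have [X [Xu dX]] := exists_stationary_field x Du.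
have [Y [Yu dY]] := exists_stationary_field y Du.
have := hG X Y a u Du; rewrite /subc.
rewrite !nablaE; [|exact: vf_differentiable|exact: vf_differentiable].
rewrite dX dY Xu Yu !add0r => /eqP; rewrite subr_eq => /eqP ->.
suff -> : lie_bracket X Y a u = 0 by rewrite add0r.
apply/rowP => i; rewrite mxE sumrB.
have H (Z W : vector_field M) : (forall z, row_derive z (vf W a) u = 0) ->
    \sum_(j < n) vf Z a u 0 j * pderiv j (fun v => vf W a v 0 i) u = 0.
  move=> dW; rewrite -derive_pderiv; last exact: vf_differentiable.
  by move/rowP: (dW (vf Z a u)) => /(_ i); rewrite !mxE.
by rewrite !H // subrr mxE.
Qed.

Lemma nabla_tensorE u x y z : D u -> forall X Y Z,
  vf X a u = x -> vf Y a u = y -> vf Z a u = z ->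
  (forall w, row_derive w (vf Y a) u = 0) -> (forall w, row_derive w (vf Z a) u = 0) ->
  nabla_tensor G c X Y Z a u = cov_mul (mu u) (fun z => dmu u z) (Ga u) x y z.
Proof.
move=> Du X Y Z Xu Yu Zu dY dZ.
have dc := tensor12_differentiable Du.
have vY := vf_differentiable Y Du; have vZ := vf_differentiable Z Du.
rewrite /nabla_tensor /subc /cov_mul nablaE; last first.
  exact: (differentiable_bil dc vY vZ).
rewrite [row_derive _ _ _](row_derive_bil dc vY vZ) dY dZ bil0l bil0r !addr0.
rewrite Xu Yu Zu; congr (_ + _ - _ - _).
- by rewrite -Yu -Zu.
- rewrite -Xu -Yu -Zu -[Ga u _ _]add0r -(dY (vf X a u)) -nablaE //.
- rewrite -Xu -Yu -Zu -[Ga u _ _]add0r -(dZ (vf X a u)) -nablaE //.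
Qed.

Lemma cov_mul_comm u x y z : D u ->
  (forall X Y Z, eq_components (nabla_tensor G c X Y Z) (nabla_tensor G c Y X Z)) ->
  cov_mul (mu u) (fun z => dmu u z) (Ga u) x y z = cov_mul (mu u) (fun z => dmu u z) (Ga u) y x z.
Proof.
move=> Du hc; have [X [Xu dX]] := exists_stationary_field x Du.
have [Y [Yu dY]] := exists_stationary_field y Du.
have [Z [Zu dZ]] := exists_stationary_field z Du.
by rewrite -(nabla_tensorE Du Xu Yu Zu) // -(nabla_tensorE Du Yu Xu Zu) // hc.
Qed.

Lemma nabla_sym u X z w : D u ->
  (forall Z W, eq_components (circ c (nabla G Z X) W) (circ c (nabla G W X) Z)) ->
  mu u (row_derive z (vf X a) u + Ga u z (vf X a u)) w =
  mu u (row_derive w (vf X a) u + Ga u w (vf X a u)) z.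
Proof.
move=> Du hX; have [Z [Zu _]] := exists_stationary_field z Du.
have [W [Wu _]] := exists_stationary_field w Du.
have vX := vf_differentiable X Du.
by have := hX Z W a u Du; rewrite /circ -!/(bil _ _ _) !nablaE // Zu Wu.
Qed.

End ComponentsAtAPoint.

(** * Commutation of the flows *)

Theorem proposition14 (R : realType) (n : nat) (M : manifold R n)
  (c : tensor12 M) (hF : F_manifold c)
  (G : connection M) (hG : torsionless G)
  (hc : forall X Y Z : vector_field M,
     eq_components (nabla_tensor G c X Y Z) (nabla_tensor G c Y X Z))
  (X Y : vector_field M)
  (hX : forall Z W : vector_field M,
     eq_components (circ c (nabla G Z X) W) (circ c (nabla G W X) Z))
  (hY : forall Z W : vector_field M,
     eq_components (circ c (nabla G Z Y) W) (circ c (nabla G W Y) Z)) :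
  forall a : chart_index M,
    flows_commute (cimg (atlas a))
      (fun u i j => \sum_(k < n) c a u i j k * vf X a u 0 k)
      (fun u i j => \sum_(k < n) c a u i j k * vf Y a u 0 k).
Proof.
move=> a i u p q Du.
have dc := tensor12_differentiable c Du.
have dX := vf_differentiable X Du; have dY := vf_differentiable Y Du.
rewrite (total_t_hydro dc _ _ _ dX dY) (total_t_hydro dc _ _ _ dY dX).
congr (fun_of_matrix _ 0 i).
apply: (@second_flow_derivativeC R n _ _ (bil (christoffel G a u))).
- exact: product_comm.
- exact: product_assoc.
- exact: bilDl.
- by move=> *; exact: product_derive_comm.
- by move=> *; exact: product_derive_assoc.
- exact: christoffel_comm.
- by move=> *; exact: cov_mul_comm.
- by move=> *; exact: nabla_sym.
- by move=> *; exact: nabla_sym.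
Qed.
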